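(* Let $k\ge 0$ be an integer and let $M$ be a sparse paving matroid of rank $r$ with ground set $E$. If $\min\{r,|E|-r\}\ge\binom{2k}{k}$, then for every basis $B$ of $M$, $M$ has a $B$-minor isomorphic to the uniform matroid $U_{k,2k}$.
   Context: A rank-$r$ matroid is sparse paving if it and its dual are paving (every circuit has size $r$ or $r+1$); equivalently its non-bases among $r$-subsets form a family $\mathcal H$ with $|H_1\cap H_2|\le r-2$ for distinct members. For a basis $B$, a $B$-minor of $M$ is a minor $(M|X)/Y$ with $Y\subseteq B\subseteq X\subseteq E$; its bases are the sets $B'\subseteq X\setminus Y$ with $B'\cup Y$ a basis of $M$. $U_{k,2k}$ is the rank-$k$ matroid on $2k$ elements in which every $k$-subset is a basis. *)

(* Defs.v *)
From mathcomp Require Import all_boot.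

Set Implicit Arguments.
Unset Strict Implicit.
Unset Printing Implicit Defensive.

(* The elements of a matroid live in an ambient finite type T; the ground set
   is a subset of T, so that minors of M stay over the same T. *)
Record matroid (T : finType) := Matroid {
  ground : {set T};
  indep : {set {set T}};
  indep_ground : forall I : {set T}, I \in indep -> I \subset ground;
  indep0 : set0 \in indep;
  indepS : forall I J : {set T}, J \in indep -> I \subset J -> I \in indep;
  indep_aug : forall I J : {set T}, I \in indep -> J \in indep -> #|I| < #|J| ->
    exists2 x, x \in J :\: I & x |: I \in indep }.

Section Basic.
Variables (T : finType) (M : matroid T).
Implicit Types (A B C I J X Y : {set T}).

Definition basis B : bool := maxset [pred I : {set T} | I \in indep M] B.

Definition circuit C : bool :=
  minset [pred A : {set T} | (A \subset ground M) && (A \notin indep M)] C.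

Definition rank : nat := \max_(I in indep M) #|I|.

Definition paving : Prop :=
  forall C, circuit C -> #|C| = rank \/ #|C| = rank.+1.

Lemma basis_indep B : basis B -> B \in indep M.
Proof. by move/maxsetp. Qed.

Lemma indep_basis_leq B I : basis B -> I \in indep M -> #|I| <= #|B|.
Proof.
move=> /maxsetP[/= iB maxB] iI; rewrite leqNgt; apply/negP => ltBI.
have [x /setDP[_ xB] ixB] := indep_aug iB iI ltBI.
by move: xB; rewrite -(maxB _ ixB (subsetUr _ _)) setU11.
Qed.

Lemma basis_card B I : basis B -> basis I = (I \in indep M) && (#|B| <= #|I|).
Proof.
move=> bB; apply/idP/andP => [bI | [iI leBI]].
  by rewrite (basis_indep bI) (indep_basis_leq bI (basis_indep bB)).
apply/maxsetP; split=> //= J iJ sIJ; apply/esym/eqP.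
by rewrite eqEcard sIJ (leq_trans (indep_basis_leq bB iJ)).
Qed.

Lemma basis_exists I : I \in indep M -> exists2 B, basis B & I \subset B.
Proof.
by move=> iI; have [B bB sIB] := @maxset_exists _ [pred J | J \in indep M] I iI;
  exists B.
Qed.

Lemma basis_extend I B : I \in indep M -> basis B ->
  exists B', [/\ basis B', I \subset B' & B' \subset I :|: B].
Proof.
move=> iI bB.
pose P := [pred J : {set T} | (J \in indep M) && (J \subset I :|: B)].
have PI : P I by rewrite /= iI subsetUl.
have [A /maxsetP[/= /andP[iA sA] maxA] sIA] := maxset_exists PI.
exists A; split=> //; rewrite (basis_card _ bB) iA /= leqNgt; apply/negP => ltAB.
have [x /setDP[xB xA] ixA] := indep_aug iA (basis_indep bB) ltAB.
have PxA : (x |: A \in indep M) && (x |: A \subset I :|: B).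
  by rewrite ixA subUset sA sub1set inE xB orbT.
by move: xA; rewrite -(maxA _ PxA (subsetUr _ _)) setU11.
Qed.

Lemma rank_basis B : basis B -> rank = #|B|.
Proof.
move=> bB; apply/eqP; rewrite eqn_leq; apply/andP; split.
  by apply/bigmax_leqP => I iI; apply: indep_basis_leq.
by apply: (bigmax_sup B); first exact: basis_indep.
Qed.

Definition dual_indep : {set {set T}} :=
  [set I : {set T} | (I \subset ground M) &&
     [exists B : {set T}, basis B && (B \subset ground M :\: I)]].

Lemma dual_indepP I :
  reflect (I \subset ground M /\ exists2 B, basis B & B \subset ground M :\: I)
          (I \in dual_indep).
Proof.
rewrite inE; apply: (iffP andP) => [[sI /existsP[B /andP[bB sB]]]|[sI [B bB sB]]].
  by split=> //; exists B.
by split=> //; apply/existsP; exists B; rewrite bB.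
Qed.

Fact dual_ground I : I \in dual_indep -> I \subset ground M.
Proof. by case/dual_indepP. Qed.

Fact dual_indep0 : set0 \in dual_indep.
Proof.
apply/dual_indepP; split; first exact: sub0set.
have [B bB _] := basis_exists (indep0 M).
by exists B => //; rewrite setD0 (indep_ground (basis_indep bB)).
Qed.

Fact dual_indepS I J : J \in dual_indep -> I \subset J -> I \in dual_indep.
Proof.
move=> /dual_indepP[sJ [B bB sB]] sIJ; apply/dual_indepP.
split; first exact: subset_trans sJ.
by exists B => //; apply: subset_trans sB (setDS _ sIJ).
Qed.

Fact dual_indep_aug I J : I \in dual_indep -> J \in dual_indep ->
  #|I| < #|J| -> exists2 x, x \in J :\: I & x |: I \in dual_indep.
Proof.
move=> /dual_indepP[sI [BI bBI sBI]] /dual_indepP[sJ [BJ bBJ sBJ]] ltIJ.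
have iBJI : BJ :\: I \in indep M := indepS (basis_indep bBJ) (subsetDl _ _).
have [B [bB sBJB sB]] := basis_extend iBJI bBI.
have dBI : [disjoint B & I].
  rewrite disjoint_subset; apply/subsetP => x /(subsetP sB).
  by rewrite !inE => /orP[/andP[]// | /(subsetP sBI)]; rewrite inE => /andP[].
case: (boolP (J :\: I \subset B)) => [sJIB | /subsetPn[x xJI xB]].
  have dJB : [disjoint J :\: I & BJ :\: I].
    rewrite disjoint_subset; apply/subsetP => x; rewrite !inE => /andP[_ xJ].
    apply/negP => /andP[_ /(subsetP sBJ)]; by rewrite inE xJ.
  have le1 : #|J :\: I| + #|BJ :\: I| <= #|BJ|.
    have /eqP <- : #|(J :\: I) :|: (BJ :\: I)| == #|J :\: I| + #|BJ :\: I|.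
      by rewrite (leq_card_setU (J :\: I) (BJ :\: I)).
    rewrite -(rank_basis bBJ) (rank_basis bB).
    by apply: subset_leq_card; rewrite subUset sJIB.
  have le2 : #|BJ :&: I| <= #|I :\: J|.
    apply: subset_leq_card; apply/subsetP => x; rewrite !inE => /andP[xBJ xI].
    by rewrite xI andbT; move: (subsetP sBJ _ xBJ); rewrite inE => /andP[].
  move: le1; rewrite -(cardsID I BJ) leq_add2r => le1.
  have := leq_trans le1 le2; rewrite leqNgt => /negP[].
  by move: ltIJ; rewrite -(cardsID J I) -(cardsID I J) setIC ltn_add2l.
exists x => //; apply/dual_indepP; split.
  by rewrite subUset sI sub1set andbT; case/setDP: xJI => /(subsetP sJ).
exists B => //; apply/subsetP => y yB.
rewrite !inE negb_or (contraTneq _ yB) => [|->//].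
by rewrite (disjointFr dBI yB) (subsetP (indep_ground (basis_indep bB)) _ yB).
Qed.

Definition dual : matroid T :=
  Matroid dual_ground dual_indep0 dual_indepS dual_indep_aug.

Definition restrict_indep X : {set {set T}} :=
  [set I in indep M | I \subset X].

Fact restrict_ground X I : I \in restrict_indep X -> I \subset X :&: ground M.
Proof. by rewrite inE subsetI => /andP[/indep_ground -> ->]. Qed.

Fact restrict_indep0 X : set0 \in restrict_indep X.
Proof. by rewrite inE indep0 sub0set. Qed.

Fact restrict_indepS X I J :
  J \in restrict_indep X -> I \subset J -> I \in restrict_indep X.
Proof.
rewrite !inE => /andP[iJ sJ] sIJ.
by rewrite (indepS iJ sIJ) (subset_trans sIJ sJ).
Qed.

Fact restrict_indep_aug X I J :
  I \in restrict_indep X -> J \in restrict_indep X -> #|I| < #|J| ->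
  exists2 x, x \in J :\: I & x |: I \in restrict_indep X.
Proof.
rewrite !inE => /andP[iI sI] /andP[iJ sJ] ltIJ.
have [x xJI ixI] := indep_aug iI iJ ltIJ.
exists x => //; rewrite inE ixI subUset sI sub1set andbT.
by case/setDP: xJI => /(subsetP sJ).
Qed.

Definition restrict X : matroid T :=
  Matroid (@restrict_ground X) (restrict_indep0 X)
          (@restrict_indepS X) (@restrict_indep_aug X).

End Basic.

Definition contract (T : finType) (M : matroid T) (Y : {set T}) : matroid T :=
  dual (restrict (dual M) (ground M :\: Y)).

Definition sparse_paving (T : finType) (M : matroid T) : Prop :=
  paving M /\ paving (dual M).

Definition Bminor (T : finType) (M : matroid T) (B : {set T}) (N : matroid T) :
    Prop :=
  exists X Y : {set T}, [/\ Y \subset B, B \subset X, X \subset ground M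
                          & N = contract (restrict M X) Y].

Section Uniform.
Variables r n : nat.
Implicit Types I J : {set 'I_n}.

Definition uniform_indep : {set {set 'I_n}} := [set I : {set 'I_n} | #|I| <= r].

Fact uniform_ground I : I \in uniform_indep -> I \subset [set: 'I_n].
Proof. by rewrite subsetT. Qed.

Fact uniform_indep0 : set0 \in uniform_indep.
Proof. by rewrite inE cards0. Qed.

Fact uniform_indepS I J :
  J \in uniform_indep -> I \subset J -> I \in uniform_indep.
Proof. by rewrite !inE => leJ /subset_leq_card/leq_trans->. Qed.

Fact uniform_indep_aug I J :
  I \in uniform_indep -> J \in uniform_indep -> #|I| < #|J| ->
  exists2 x, x \in J :\: I & x |: I \in uniform_indep.
Proof.
rewrite !inE => _ leJ ltIJ.
have /subsetPn[x xJ xI] : ~~ (J \subset I).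
  by apply/negP => /subset_leq_card; rewrite leqNgt ltIJ.
by exists x; rewrite !inE ?xI // cardsU1 xI (leq_trans ltIJ).
Qed.

Definition uniform : matroid 'I_n :=
  Matroid uniform_ground uniform_indep0 uniform_indepS uniform_indep_aug.

End Uniform.

(* The bijection is between the ground sets as types: a function between the
   ambient types need not exist when one of them is empty. *)
Definition isomorphic (T U : finType) (M : matroid T) (N : matroid U) : Prop :=
  exists2 f : {x : T | x \in ground M} -> {y : U | y \in ground N},
    bijective f &
    forall A : {set {x : T | x \in ground M}},
      ([set val (f x) | x in A] \in indep N) = ([set val x | x in A] \in indep M).

Section Sanity.
Variable T : finType.
Implicit Types (M : matroid T) (B X Y : {set T}).

Lemma basis_dual M B :
  basis (dual M) B = (B \subset ground M) && basis M (ground M :\: B).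
Proof.
have [B0 bB0 _] := basis_exists (indep0 M).
apply/idP/andP => [bB | [sB bB]].
  have /dual_indepP[sB [B1 bB1 sB1]] := basis_indep bB; split=> //.
  have iB1 : ground M :\: B1 \in dual_indep M.
    apply/dual_indepP; split; first exact: subsetDl.
    exists B1 => //; apply/subsetP => x xB1.
    by rewrite !inE xB1 (subsetP (indep_ground (basis_indep bB1)) _ xB1).
  have /maxsetP[_ maxB] := bB.
  rewrite -(maxB _ iB1); last first.
    apply/subsetP => x xB; rewrite inE (subsetP sB) // andbT.
    by apply/negP => /(subsetP sB1); rewrite inE xB.
  rewrite setDDr setDv set0U.
  by rewrite (setIidPr (indep_ground (basis_indep bB1))).
apply/maxsetP; split=> [|J /= /dual_indepP[sJ [B1 bB1 sB1]] sBJ].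
  by apply/dual_indepP; split=> //; exists (ground M :\: B).
have e : B1 = ground M :\: B.
  apply/eqP; rewrite eqEcard (subset_trans sB1 (setDS _ sBJ)) /=.
  by rewrite -(rank_basis bB1) (rank_basis bB).
apply/eqP; rewrite eqEsubset sBJ andbT; apply/subsetP => x xJ.
apply/negPn/negP => xB.
have : x \in B1 by rewrite e inE xB (subsetP sJ).
by move/(subsetP sB1); rewrite inE xJ.
Qed.

Lemma basis_restrict M B X B' : basis M B -> B \subset X ->
  basis (restrict M X) B' = (B' \subset X) && basis M B'.
Proof.
move=> bB sBX.
have iB : B \in indep (restrict M X) by rewrite inE (basis_indep bB).
have bBX : basis (restrict M X) B.
  apply/maxsetP; split=> //= J; rewrite inE => /andP[iJ _] sBJ.
  by have /maxsetP[_ maxB] := bB; apply: maxB.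
by rewrite (basis_card _ bB) (basis_card _ bBX) inE andbAC andbC.
Qed.

Lemma ground_Bminor M X Y : X \subset ground M ->
  ground (contract (restrict M X) Y) = X :\: Y.
Proof.
move=> sX /=; rewrite (setIidPl sX); apply/setIidPl; exact: subsetDl.
Qed.

Lemma basis_Bminor M B X Y B' : basis M B -> Y \subset B -> B \subset X ->
  X \subset ground M ->
  basis (contract (restrict M X) Y) B' =
  (B' \subset X :\: Y) && basis M (B' :|: Y).
Proof.
move=> bB sYB sBX sX.
rewrite basis_dual -/(contract _ Y) ground_Bminor //.
case: (boolP (B' \subset X :\: Y)) => //= sB'.
have gX : ground (restrict M X) = X by apply/setIidPl.
have bBX : basis (dual (restrict M X)) (X :\: B).
  rewrite basis_dual gX subsetDl setDDr setDv set0U (setIidPr sBX).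
  by rewrite (basis_restrict _ bB sBX) sBX bB.
rewrite -/(ground (restrict M X)) (setIidPl sX).
rewrite (basis_restrict _ bBX (setDS _ sYB)) subsetDl /= basis_dual gX.
rewrite (subset_trans (subsetDl _ _) (subsetDl _ _)) /=.
rewrite (basis_restrict _ bB sBX) subsetDl /=; congr (basis M _).
apply/setP => x; rewrite !inE.
move/subsetP/(_ x)/implyP: sB'; move/subsetP/(_ x)/implyP: sBX.
move/subsetP/(_ x)/implyP: sYB; rewrite !inE.
by case: (x \in B'); case: (x \in Y); case: (x \in X); case: (x \in B).
Qed.

Lemma basis_uniform r n (B : {set 'I_n}) : r <= n ->
  basis (uniform r n) B = (#|B| == r).
Proof.
move=> le_rn; pose B0 := [set widen_ord le_rn i | i : 'I_r].
have cB0 : #|B0| = r.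
  by rewrite card_imset ?card_ord // => i j /(congr1 val) /= /val_inj.
have bB0 : basis (uniform r n) B0.
  apply/maxsetP; split=> [|J] /=; rewrite inE ?cB0 // => leJ sJ.
  by apply/esym/eqP; rewrite eqEcard sJ cB0.
by rewrite (basis_card _ bB0) inE cB0 eqn_leq.
Qed.

End Sanity.

(* Main.v *)
Require Import Defs.
From mathcomp Require Import all_boot zify.

Set Implicit Arguments.
Unset Strict Implicit.
Unset Printing Implicit Defensive.

(** In a sparse paving matroid of rank [r], for every set [A] of [r - 1] elements
    at most one [x] makes [x |: A] a non-basis. Sets [S \subset B] and
    [P \subset E \ B] are grown greedily, alternating between the two, so that
    exchanging [S] for any [#|S|]-subset of [S :|: P] turns [B] into a basis.
    Each set that could spoil the next step spoils it for at most one choice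
    of the new element, and there are at most [C(2i+1, i)] such sets when
    [#|P| = i]; together with the [i] elements already used, these are fewer
    than the [C(2k, k)] elements available. *)

(** * Pigeonhole and interpolation for finite sets *)

Section FiniteSets.
Variables aT rT : finType.

(** Pigeonhole: if every element of [D] were spoiled, sending each [a] to the element it spoils
    would map [A] onto a set containing [D]. *)
Lemma exists_unspoiled (A : {set aT}) (D : {set rT}) (bad : aT -> rT -> bool) :
    (forall a x y, a \in A -> x \in D -> y \in D -> bad a x -> bad a y -> x = y) ->
    #|A| < #|D| ->
  exists2 x, x \in D & forall a, a \in A -> ~~ bad a x.
Proof.
move=> bad_uniq ltAD.
case: (boolP [exists x in D, forall a in A, ~~ bad a x]).
  by case/exists_inP=> x xD /forall_inP; exists x.
rewrite negb_exists_in => /forall_inP spoiled.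
(* The value is [None] when [a] spoils nothing, so [D] is compared with the image of [f] through the
   injection [Some]. *)
pose f a := [pick x in D | bad a x].
have sub : Some @: D \subset f @: A.
  apply/subsetP => _ /imsetP[x xD ->].
  have := spoiled x xD; rewrite negb_forall_in => /exists_inP[a aA].
  rewrite negbK => bad_ax; apply/imsetP; exists a => //; rewrite /f.
  case: pickP => [y /andP[yD bad_ay] | /(_ x)]; last by rewrite xD bad_ax.
  by rewrite (bad_uniq a x y).
have := leq_trans (subset_leq_card sub) (leq_imset_card f A).
by rewrite card_imset => [|x y []//]; rewrite leqNgt ltAD.
Qed.

Lemma exists_superset_card (A C : {set aT}) n :
    A \subset C -> #|A| <= n <= #|C| ->
  exists D : {set aT}, [/\ A \subset D, D \subset C & #|D| = n].
Proof.
elim: n => [|n IHn] sAC /andP[leA leC].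
  by exists A; split=> //; apply/eqP; rewrite -leqn0.
move: leA; rewrite leq_eqVlt => /orP[/eqP eqA | ltA]; first by exists A.
have [|D [sAD sDC cD]] := IHn sAC; first by rewrite -ltnS ltA ltnW.
have /subsetPn[x xC xD] : ~~ (C \subset D).
  by apply/negP => /subset_leq_card; rewrite cD leqNgt leC.
exists (x |: D); rewrite subUset sub1set xC sDC cardsU1 xD cD; split=> //.
exact: subset_trans sAD (subsetUr _ _).
Qed.

End FiniteSets.

(** * Binomial estimates *)

Lemma leq_central_bin i k : i <= k -> 'C(2 * i, i) <= 'C(2 * k, k).
Proof.
move/subnK <-; elim: (k - i) => // d IHd; apply: leq_trans IHd _.
rewrite addSn mulnS !addSn add0n binS; apply: leq_trans (leq_addr _ _).
by rewrite binS leq_addl.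
Qed.

(** This leaves room for the [i] elements already used in the greedy growth. *)
Lemma ltn_bin_double_succ i : i < 'C((2 * i).+1, i).
Proof.
elim: i => // i IHi; rewrite mulnS !addSn add0n binS.
have : 'C((2 * i).+1, i) <= 'C((2 * i).+2, i).
  by case: i {IHi} => // i; rewrite binS leq_addr.
have : 0 < 'C((2 * i).+2, i.+1) by rewrite bin_gt0; lia.
lia.
Qed.

(** * Uniform and paving matroids *)

Lemma isomorphic_uniform (T : finType) (N : matroid T) r n :
    #|ground N| = n ->
    (forall I : {set T}, I \subset ground N -> (I \in indep N) = (#|I| <= r)) ->
  isomorphic N (uniform r n).
Proof.
move=> cN iN.
have eqc : #|{: {x : T | x \in ground N}}| =
           #|{: {y : 'I_n | y \in ground (uniform r n)}}|.
  by rewrite !card_sig cN /= -[RHS]/#|[set: 'I_n]| cardsT card_ord.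
(* Any bijection of the ground sets works, since independence depends only on cardinality on both
   sides; this one matches two enumerations. *)
pose f x := enum_val (cast_ord eqc (enum_rank x)).
have bij_f : bijective f.
  exists (fun y => enum_val (cast_ord (esym eqc) (enum_rank y))) => x.
    by rewrite enum_valK cast_ordK enum_rankK.
  by rewrite /f enum_valK cast_ordKV enum_rankK.
exists f => // A.
rewrite inE iN; last by apply/subsetP => _ /imsetP[x _ ->]; apply: valP.
rewrite (card_imset _ val_inj) card_imset // => x y /val_inj.
exact: (bij_inj bij_f).
Qed.

Lemma paving_indep (T : finType) (M : matroid T) (A : {set T}) :
  paving M -> A \subset ground M -> #|A| < rank M -> A \in indep M.
Proof.
move=> pM sA ltA; apply: contraLR (ltA) => niA; rewrite -leqNgt.
have PA : [pred A : {set T} | (A \subset ground M) && (A \notin indep M)] A.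
  by rewrite /= sA.
have [C cC /subset_leq_card] := minset_exists PA; apply: leq_trans.
by case: (pM C cC) => ->.
Qed.

(** * Non-bases of a sparse paving matroid *)

Section SparsePaving.
Variables (T : finType) (M : matroid T).
Implicit Types A B I S P U : {set T}.

Lemma rank_dual : rank (dual M) = #|ground M| - rank M.
Proof.
have [B bB _] := basis_exists (indep0 M).
have sB := indep_ground (basis_indep bB).
have bD : basis (dual M) (ground M :\: B).
  by rewrite basis_dual subsetDl setDDr setDv set0U (setIidPr sB).
by rewrite (rank_basis bD) (rank_basis bB) cardsD (setIidPr sB).
Qed.

Lemma basis_indep_card I : basis M I = (I \in indep M) && (#|I| == rank M).
Proof.
have [B bB _] := basis_exists (indep0 M).
rewrite (basis_card _ bB) (rank_basis bB) eqn_leq.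
by case: (boolP (I \in indep M)) => //= /(indep_basis_leq bB) ->.
Qed.

Hypothesis hM : sparse_paving M.

(** If [x] and [y] differ, [A] with both added has [rank M + 1] elements and, the dual being paving,
    contains a basis. Augmenting the independent set [A] from that basis adds [x] or [y], so one of
    the two extensions is a basis. *)
Lemma sparse_paving_nonbasis_uniq A x y :
    A \subset ground M -> #|A|.+1 = rank M ->
    x \in ground M :\: A -> y \in ground M :\: A ->
    ~~ basis M (x |: A) -> ~~ basis M (y |: A) ->
  x = y.
Proof.
case: hM => pM pD sA cA /setDP[xE xA] /setDP[yE yA] nx ny.
apply/eqP; apply: contraT => neq_xy.
have iA : A \in indep M by apply: paving_indep => //; rewrite -cA.
pose C := x |: (y |: A).
have sC : C \subset ground M by rewrite !subUset !sub1set xE yE.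
have cC : #|C| = (rank M).+1.
  by rewrite !cardsU1 !inE (negPf neq_xy) (negPf xA) (negPf yA) -cA.
(* The complement of [C] has one element fewer than the rank of the dual. *)
have /dual_indepP[_ [B bB sB]] : ground M :\: C \in indep (dual M).
  apply: (paving_indep pD); first exact: subsetDl.
  have leC := subset_leq_card sC.
  by rewrite rank_dual cardsD (setIidPr sC); lia.
have [|z /setDP[zB zA] iz] := indep_aug iA (basis_indep bB).
  by rewrite -(rank_basis bB) -cA.
have bz : basis M (z |: A) by rewrite basis_indep_card iz cardsU1 zA /= -cA.
have := subsetP sB z zB; rewrite !inE (negPf zA) orbF.
case: eqP => [ezx|_]; first by move: nx; rewrite -ezx bz.
case: eqP => [ezy|_]; first by move: ny; rewrite -ezy bz.
by rewrite /= andNb.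
Qed.

(** * Growing exchanges from a fixed basis *)

Variable B : {set T}.
Hypothesis bB : basis M B.

(** Uniformity of the minor on [S :|: P] got by contracting [B :\: S], phrased with bases of [M] so
    that the greedy growth never handles minors. *)
Definition all_exchanges S P : Prop :=
  [/\ S \subset B, P \subset ground M :\: B
    & forall U, U \subset S :|: P -> #|U| = #|S| -> basis M ((B :\: S) :|: U)].

Lemma disjoint_exchanged S P U :
  P \subset ground M :\: B -> U \subset S :|: P -> [disjoint B :\: S & U].
Proof.
move=> sP sU; rewrite disjoint_subset; apply/subsetP => x.
rewrite !inE => /andP[xS xB]; apply/negP => /(subsetP sU).
by rewrite !inE (negPf xS) => /(subsetP sP); rewrite inE xB.
Qed.

Lemma card_exchanged S P U : S \subset B ->
    P \subset ground M :\: B -> U \subset S :|: P ->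
  #|(B :\: S) :|: U| = rank M - #|S| + #|U|.
Proof.
move=> sS sP sU; rewrite cardsU disjoint_setI0 ?cards0 ?subn0.
  by rewrite cardsD (setIidPr sS) (rank_basis bB).
exact: disjoint_exchanged sU.
Qed.

Lemma sub_exchanged S P U : S \subset B ->
    P \subset ground M :\: B -> U \subset S :|: P ->
  (B :\: S) :|: U \subset ground M.
Proof.
have sB := indep_ground (basis_indep bB).
move=> sS sP sU; rewrite subUset (subset_trans (subsetDl _ _) sB) /=.
apply: subset_trans sU _; rewrite subUset (subset_trans sS sB).
exact: subset_trans sP (subsetDl _ _).
Qed.

(** After adding [s], an exchange using [s] is an old one, so only the sets [U] of [#|S| + 1]
    elements of [S :|: P] can spoil [s]. For such [U], the candidates are [W] minus one element,
    where [W] has [rank M + 1] elements; at most one deletion fails. *)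
Lemma grow_in_basis S P : all_exchanges S P ->
    'C(#|S :|: P|, #|S|.+1) < #|B :\: S| ->
  exists2 s, s \in B :\: S & all_exchanges (s |: S) P.
Proof.
move=> [sS sP exSP]; rewrite -cards_draws.
pose bad U s := ~~ basis M ((B :\: (s |: S)) :|: U).
move/(@exists_unspoiled _ _ _ _ bad) => [U s t | s sBS good].
  rewrite inE => /andP[sU /eqP cU] sBS tBS bads badt.
  apply/eqP; apply: contraT => neq_st.
  have dU := disjoint_exchanged sP sU.
  pose W := (B :\: S) :|: U.
  have sW : s \in W by rewrite inE sBS.
  have tW : t \in W by rewrite inE tBS.
  have delE u : u \in B :\: S -> (B :\: (u |: S)) :|: U = W :\ u.
    move=> uBS; have /negbT uU := disjointFr dU uBS.
    apply/setP => v; rewrite !inE; case: eqVneq => [->|] //=.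
    by rewrite (negPf uU).
  (* The equation is reversed because deleting [s] from [W] amounts to adding [t] to [W :\ s :\ t],
     and conversely. *)
  rewrite -(negPf neq_st); apply/eqP/esym.
  have cW : #|W| = (rank M).+1.
    have := subset_leq_card sS; rewrite -(rank_basis bB) => leS.
    by rewrite (card_exchanged sS sP sU) cU; lia.
  have gW : W \subset ground M := sub_exchanged sS sP sU.
  have eWs : W :\ s = t |: (W :\ s :\ t).
    by rewrite setD1K // in_setD1 eq_sym neq_st tW.
  have eWt : W :\ t = s |: (W :\ s :\ t).
    by rewrite setDDl [[set s] :|: [set t]]setUC -setDDl setD1K // in_setD1 neq_st sW.
  apply: (@sparse_paving_nonbasis_uniq (W :\ s :\ t)).
  - by rewrite !(subset_trans (subsetDl _ _)).
  - apply/eqP; rewrite -eqSS -cW (cardsD1 s W) sW (cardsD1 t (W :\ s)).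
    by rewrite in_setD1 (eq_sym t) neq_st tW.
  - by rewrite inE (subsetP gW) // !inE eqxx.
  - by rewrite inE (subsetP gW) // !inE eqxx /= andbF.
  - by rewrite -eWs -delE.
  - by rewrite -eWt -delE.
have /setDP[sB sNS] := sBS.
exists s => //; split=> //; first by rewrite subUset sub1set sB.
move=> U sU; rewrite cardsU1 sNS => cU.
have [sinU | sNU] := boolP (s \in U).
  suff -> : (B :\: (s |: S)) :|: U = (B :\: S) :|: (U :\ s).
    apply: exSP; last by move: cU; rewrite (cardsD1 s) sinU => -[].
    by rewrite subDset setUA.
  apply/setP => v; rewrite !inE; case: eqVneq => [->|] //=.
  by rewrite sinU sNS sB.
have := good U; rewrite inE cU eqxx andbT negbK; apply.
apply/subsetP => v vU; have := subsetP sU v vU; rewrite !inE.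
by case: eqVneq vU sNU => [->->|].
Qed.

(** The new exchanges are those using [p]. Removing [p] leaves [#|S| - 1] elements of [S :|: P],
    which together with [B :\: S] form a set of [rank M - 1] elements, and at most one [p] extends
    it to a non-basis. *)
Lemma grow_off_basis S P : all_exchanges S P -> 0 < #|S| ->
    'C(#|S :|: P|, #|S|.-1) < #|(ground M :\: B) :\: P| ->
  exists2 p, p \in (ground M :\: B) :\: P & all_exchanges S (p |: P).
Proof.
move=> [sS sP exSP] S_gt0; rewrite -cards_draws.
pose bad U p := ~~ basis M (p |: ((B :\: S) :|: U)).
move/(@exists_unspoiled _ _ _ _ bad) => [U p q | p pD good].
  rewrite inE => /andP[sU /eqP cU] pD qD badp badq.
  have outW u : u \in (ground M :\: B) :\: P ->
      u \in ground M :\: ((B :\: S) :|: U).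
    rewrite !inE => /and3P[uP uB ->]; rewrite (negPf uB) andbF /= andbT.
    apply/negP => /(subsetP sU); rewrite inE (negPf uP) orbF.
    by move/(subsetP sS); rewrite (negPf uB).
  apply: sparse_paving_nonbasis_uniq badp badq; rewrite ?outW //.
    exact: sub_exchanged sU.
  have := subset_leq_card sS; rewrite -(rank_basis bB) => leS.
  by rewrite (card_exchanged sS sP sU) cU; lia.
have /setDP[pEB pP] := pD.
exists p => //; split=> //; first by rewrite subUset sub1set pEB.
move=> U sU cU; have [pU | pNU] := boolP (p \in U).
  have := good (U :\ p); rewrite inE negbK /bad setUCA setD1K //; apply.
  move: cU; rewrite (cardsD1 p) pU => <- /=; rewrite eqxx andbT.
  by rewrite subDset setUCA.
apply: exSP => //; apply/subsetP => v vU; have := subsetP sU v vU; rewrite !inE.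
by case: eqVneq vU pNU => [->->|].
Qed.

(** * The greedy construction and the resulting minor *)

Lemma all_exchanges_exists k :
    'C(2 * k, k) <= minn (rank M) (#|ground M| - rank M) ->
  exists S P, [/\ all_exchanges S P, #|S| = k & #|P| = k].
Proof.
move=> hk.
suff /(_ k (leqnn k)) : forall i, i <= k ->
  exists S P, [/\ all_exchanges S P, #|S| = i & #|P| = i] by [].
have sB := indep_ground (basis_indep bB).
elim=> [_ | i IHi lt_ik].
  exists set0, set0; rewrite cards0; split=> //; split; rewrite ?sub0set //.
  by move=> U _ /eqP; rewrite cards0 cards_eq0 => /eqP ->; rewrite setD0 setU0.
have [S [P [exSP cS cP]]] := IHi (ltnW lt_ik).
have dSP S' P' : all_exchanges S' P' -> #|S' :|: P'| = #|S'| + #|P'|.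
  case=> sS' sP' _; rewrite cardsU disjoint_setI0 ?cards0 ?subn0 //.
  rewrite disjoint_subset; apply/subsetP => x /(subsetP sS') xB.
  by apply/negP => /(subsetP sP'); rewrite inE xB.
have bound := leq_trans (leq_central_bin lt_ik) hk.
have lt_i := ltn_bin_double_succ i.
have bin_sym : 'C((2 * i).+1, i.+1) = 'C((2 * i).+1, i).
  by rewrite -bin_sub; [congr ('C(_, _)); lia | lia].
have bin1 : 'C(2 * i, i.+1) <= 'C((2 * i).+1, i.+1) by rewrite binS leq_addr.
(* By Pascal's rule and symmetry, ['C(2i+2, i+1)] is twice ['C(2i+1, i)]. One copy bounds the number
   of spoiling sets in either growth step; the other exceeds [i], the number of elements already
   used on that side. *)
move: bound; rewrite mulnS !addSn add0n binS leq_min => /andP[bound1 bound2].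
have [|s /setDP[_ sS] exSP1] := grow_in_basis exSP.
  case: (exSP) => sSB _ _; rewrite (dSP _ _ exSP) cS cP.
  rewrite cardsD (setIidPr sSB) -(rank_basis bB) cS addnn -mul2n; lia.
have cS1 : #|s |: S| = i.+1 by rewrite cardsU1 sS cS.
have [||p /setDP[_ pP] exSP2] := grow_off_basis exSP1; first by rewrite cS1.
  case: (exSP1) => _ sPD _; rewrite (dSP _ _ exSP1) cS1 cP addSn addnn -mul2n /=.
  rewrite cardsD (setIidPr sPD) cardsD (setIidPr sB) -(rank_basis bB) cP; lia.
by exists (s |: S), (p |: P); rewrite cS1 cardsU1 pP cP.
Qed.

Lemma all_exchanges_uniform S P k :
    all_exchanges S P -> #|S| = k -> #|P| = k ->
  isomorphic (contract (restrict M (B :|: P)) (B :\: S)) (uniform k (2 * k)).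
Proof.
move=> [sS sP exSP] cS cP.
have sB := indep_ground (basis_indep bB).
have sX : B :|: P \subset ground M.
  by rewrite subUset sB (subset_trans sP (subsetDl _ _)).
have eXY : (B :|: P) :\: (B :\: S) = S :|: P.
  apply/setP => x; rewrite !inE; move/subsetP/(_ x)/implyP: sS.
  move/subsetP/(_ x)/implyP: sP; rewrite !inE.
  by case: (x \in B); case: (x \in P); case: (x \in S).
set N := contract _ _.
have gN : ground N = S :|: P by rewrite ground_Bminor.
have bN U : basis N U = (U \subset S :|: P) && basis M (U :|: (B :\: S)).
  by rewrite (basis_Bminor _ bB) ?subsetDl ?subsetUl // eXY.
have cG : #|S :|: P| = 2 * k.
  rewrite cardsU disjoint_setI0 ?cards0 ?subn0 ?cS ?cP; first by lia.
  rewrite disjoint_subset; apply/subsetP => x /(subsetP sS) xB.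
  by apply/negP => /(subsetP sP); rewrite inE xB.
have bS : basis N S by rewrite bN subsetUl setUC exSP ?subsetUl.
apply: isomorphic_uniform => [|I]; rewrite gN // => sI.
apply/idP/idP => [iI | leI]; first by rewrite -cS (indep_basis_leq bS).
(* A set of at most [k] elements extends to a [k]-subset of [S :|: P], which is a basis of the minor
   by the exchange property. *)
have [|U [sIU sU cU]] := @exists_superset_card _ _ _ k sI.
  by rewrite leI cG; lia.
apply: indepS sIU; apply: basis_indep.
by rewrite bN sU setUC exSP ?cU.
Qed.

End SparsePaving.

Theorem theorem5p5 (T : finType) (M : matroid T) (k r : nat)
    (hM : sparse_paving M) (hr : rank M = r)
    (hk : 'C(2 * k, k) <= minn r (#|ground M| - r)) (B : {set T})
    (hB : basis M B) :
  exists N : matroid T, Bminor M B N /\ isomorphic N (uniform k (2 * k)).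
Proof.
rewrite -hr in hk.
have [S [P [exSP cS cP]]] := @all_exchanges_exists T M hM B hB k hk.
exists (contract (restrict M (B :|: P)) (B :\: S)); split; last first.
  exact: all_exchanges_uniform.
exists (B :|: P), (B :\: S); split; rewrite ?subsetDl ?subsetUl //.
have [_ sP _] := exSP; rewrite subUset (indep_ground (basis_indep hB)).
exact: subset_trans sP (subsetDl _ _).
Qed.
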